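(* Let $$U_8=S_0\otimes S_0\otimes S_0+S_1\otimes S_3\otimes S_0+S_2\otimes S_0\otimes S_1+S_3\otimes S_2\otimes S_1+S_0\otimes S_1\otimes S_2+S_1\otimes S_2\otimes S_2+S_2\otimes S_1\otimes S_3+S_3\otimes S_3\otimes S_3.$$ Then $\mathrm{sr}(U_8)\in\{7,8\}$.
   Context: $S_0=\begin{bmatrix}1&0\\0&0\end{bmatrix}$, $S_1=\begin{bmatrix}0&1\\0&0\end{bmatrix}$, $S_2=\begin{bmatrix}0&0\\1&0\end{bmatrix}$, $S_3=\begin{bmatrix}0&0\\0&1\end{bmatrix}$. For a matrix $U$ on $\mathbb{C}^2\otimes\mathbb{C}^2\otimes\mathbb{C}^2$ (systems $A,B,C$), its Schmidt rank $\mathrm{sr}(U)$ is the least integer $r$ such that $U=\sum_{j=1}^r A_j\otimes B_j\otimes C_j$ with $A_j,B_j,C_j$ complex $2\times 2$ matrices (i.e. the tensor rank of $U$). *)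

(* Defs.v *)
From HB Require Import structures.
From mathcomp Require Import all_boot all_algebra.
From mathcomp Require Import complex mxtens.
From mathcomp Require Import reals.
Set Implicit Arguments. Unset Strict Implicit. Unset Printing Implicit Defensive.
Import GRing.Theory Num.Theory.
Local Open Scope ring_scope.

(* The complex numbers are modelled as R[i] for R : realType
   (R a complete archimedean ordered field, i.e. the reals). *)

Definition S0 {K : pzRingType} : 'M[K]_2 := delta_mx 0 0.
Definition S1 {K : pzRingType} : 'M[K]_2 := delta_mx 0 1.
Definition S2 {K : pzRingType} : 'M[K]_2 := delta_mx 1 0.
Definition S3 {K : pzRingType} : 'M[K]_2 := delta_mx 1 1.

Definition tens3 {K : pzRingType} (A B C : 'M[K]_2) : 'M[K]_(2 * 2 * 2) :=
  (A *t B) *t C.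

Definition sr_le {K : pzRingType} (U : 'M[K]_(2 * 2 * 2)) (r : nat) : Prop :=
  exists (A B C : 'I_r -> 'M[K]_2), U = \sum_(j < r) tens3 (A j) (B j) (C j).

Definition is_sr {K : pzRingType} (U : 'M[K]_(2 * 2 * 2)) (r : nat) : Prop :=
  sr_le U r /\ forall r', sr_le U r' -> (r <= r')%N.

Definition U8 {K : pzRingType} : 'M[K]_(2 * 2 * 2) :=
  tens3 S0 S0 S0 + tens3 S1 S3 S0 + tens3 S2 S0 S1 + tens3 S3 S2 S1
  + tens3 S0 S1 S2 + tens3 S1 S2 S2 + tens3 S2 S1 S3 + tens3 S3 S3 S3.

(* Main.v *)
Require Import Defs.
From mathcomp Require Import all_boot all_algebra.
From mathcomp Require Import complex mxtens reals.
From mathcomp Require Import boolp ring.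
Set Implicit Arguments. Unset Strict Implicit. Unset Printing Implicit Defensive.
Import GRing.Theory.
Local Open Scope ring_scope.

(* Contracting systems A, B, C turns U8 into a trilinear form T(y, z, x) on K^4.
   Suppose T = sum_(j < 6) a_j(y) b_j(z) c_j(x).
   - Any three of the a_j are independent, and likewise for b and c: otherwise
     T restricted to a plane would be a sum of three products.
   - A nonzero contraction of T with x (or z) has rank at least 2, so two
     dependent 4-subsets of the c_j (or of the b_j) share at most 2 indices, i.e.
     their complements form a matching on the six indices.
   - For a split {i,j,k} | {l,m,n} take x killed by c_i, c_j, c_k and z killed by
     b_l, b_m, b_n, so that T(., z, x) = 0.  By block-diagonality z can be replaced
     by a vector whose contraction has rank 2; independence then forces some
     c_i, c_j, c_k, c_p with p in {l,m,n}, or some b_l, b_m, b_n, b_q with q in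
     {i,j,k}, to be dependent.
   - For any two matchings on six points some split into triples has no edge of
     the first inside one triple and no edge of the second inside the other. *)

(** * Matchings on six points *)

Section Matchings.

Fixpoint words n : seq (seq nat) :=
  if n is m.+1 then [seq a :: w | a <- iota 0 6, w <- words m]
  else [:: [::]].

(* Words of length 6 encode maps of {0..5}; a matching is encoded by the
   involution exchanging matched points and fixing the others. *)
Definition involutive_word (s : seq nat) :=
  all (fun i => nth 0%N s (nth 0%N s i) == i) (iota 0 6).

Definition splits : seq (seq nat) :=
  [seq w ++ filter (fun i => i \notin w) (iota 0 6) |
    w <- words 3 & sorted ltn w].

(** The alternative [i == j] tolerates fixed points, since these encode unmatched points rather than
    edges. *)
Definition avoids (s : seq nat) (w : seq nat) :=
  all (fun i => all (fun j => (i == j) || (nth 0%N s i != j)) w) w.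

(** Finite check: there are 76 involutions on six points, and every ordered pair of them is tested
    against the 20 splits. *)
Lemma involutive_words_split :
  let L := filter involutive_word (words 6) in
  all (fun s => all (fun t =>
    has (fun w => avoids s (take 3 w) && avoids t (drop 3 w)) splits) L) L.
Proof. by vm_compute. Qed.

Lemma mem_words n s : size s = n -> all (fun i => (i < 6)%N) s -> s \in words n.
Proof.
elim: n s => [|n IHn] [|a s] // [sz] /andP[a6 s6].
by apply: allpairs_f; [rewrite mem_iota | apply: IHn].
Qed.

Definition matching (T : eqType) (E : rel T) :=
  symmetric E /\ forall i j k, E i j -> E i k -> j = k.

Lemma matching_word (E : rel 'I_6) : matching E ->
  exists2 s, s \in filter involutive_word (words 6) &
    forall i j : 'I_6, E i j -> nth 0%N s i = j.
Proof.
move=> [Esym Euniq].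
(* The default value [i] makes unmatched points fixed, which turns the partial pairing into a total
   involution. *)
pose f i := odflt i [pick j | E i j].
have fE i j : E i j -> f i = j.
  by rewrite /f; case: pickP => [k Ek Ej|/(_ j)->] //=; exact: Euniq Ek Ej.
have fK i : f (f i) = i.
  rewrite {2}/f; case: pickP => [k Ek|h] /=; first by apply: fE; rewrite Esym.
  by rewrite /f; case: pickP => // k; rewrite h.
have nthf (i : 'I_6) : nth 0%N [seq val (f i) | i <- enum 'I_6] i = f i.
  by rewrite (nth_map i) ?size_enum_ord ?nth_ord_enum.
exists [seq val (f i) | i <- enum 'I_6]; last by move=> i j /fE <-.
rewrite mem_filter; apply/andP; split.
  apply/allP => i; rewrite mem_iota /= => i6.
  by rewrite (nthf (Ordinal i6)) nthf fK.
apply: mem_words; first by rewrite size_map size_enum_ord.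
by apply/allP => _ /mapP[i _ ->] /=.
Qed.

Lemma matchings_split (E1 E2 : rel 'I_6) : matching E1 -> matching E2 ->
  exists i j k l m n : 'I_6, uniq [:: i; j; k; l; m; n] /\
   ([|| E1 i j, E1 i k | E1 j k] || [|| E2 l m, E2 l n | E2 m n]) = false.
Proof.
move=> /matching_word[s sL sE] /matching_word[t tL tE].
have /allP/(_ _ sL)/allP/(_ _ tL)/hasP[w wS /andP[avs avt]] := involutive_words_split.
have : all (fun w => [&& size w == 6, uniq w & all (fun i => i < 6)%N w]) splits.
  by vm_compute.
move=> /allP/(_ _ wS)/and3P[/eqP szw uw aw].
move: szw uw aw avs avt => {wS}.
case: w => [|i [|j [|k [|l [|m [|n []]]]]]] // _ uw.
move=> /= /and5P[hi hj hk hl /and3P[hm hn _]] avs avt.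
exists (Ordinal hi), (Ordinal hj), (Ordinal hk),
       (Ordinal hl), (Ordinal hm), (Ordinal hn); split.
  exact: uw.
have nE (E : rel 'I_6) u v (p q : 'I_6) : avoids u v ->
    (forall i j : 'I_6, E i j -> nth 0%N u i = j) ->
    (p : nat) \in v -> (q : nat) \in v -> p != q -> E p q = false.
  move=> /allP av uE pv qv npq; apply/negP => /uE eq.
  by have /allP/(_ _ qv) := av _ pv; rewrite eq eqxx orbF (inj_eq val_inj) (negbTE npq).
move: uw; rewrite /= !inE !negb_or.
move=> /and5P[/and5P[ij ik _ _ _] /and4P[jk _ _ _] _ /andP[lm ln] /andP[mn _]].
by rewrite !(nE _ _ _ _ _ avs sE) ?(nE _ _ _ _ _ avt tE) ?inE ?eqxx ?orbT.
Qed.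

End Matchings.

(** * Linear forms on a four-dimensional space and their common zeros *)

Section LinearForms.
Variable F : fieldType.
Implicit Types (x : 'rV[F]_4) (c : 'cV[F]_4).

Definition ev x c : F := (x *m c) 0 0.

Definition row4 (p q r s : F) : 'rV[F]_4 := \row_k nth 0 [:: p; q; r; s] k.

Lemma ev_eq0 x c : ev x c = 0 -> x *m c = 0.
Proof. by move=> h; apply/matrixP => i j; rewrite !ord1 [LHS]h mxE. Qed.

Definition cols3 (c1 c2 c3 : 'cV[F]_4) : 'M[F]_(4, 1 + (1 + 1)) := row_mx c1 (row_mx c2 c3).

Lemma mul_cols3 x c1 c2 c3 :
  (x *m cols3 c1 c2 c3 = 0) <-> [/\ ev x c1 = 0, ev x c2 = 0 & ev x c3 = 0].
Proof.
rewrite /cols3 !mul_mx_row; split.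
  move/eqP; rewrite !row_mx_eq0 => /and3P[/eqP h1 /eqP h2 /eqP h3].
  by rewrite /ev h1 h2 h3 !mxE.
by case=> /ev_eq0-> /ev_eq0-> /ev_eq0->; rewrite !row_mx0.
Qed.

Lemma kernel_vector (n : nat) (M : 'M[F]_(4, n)) :
  (\rank M < 4)%N -> exists2 x : 'rV_4, x != 0 & x *m M = 0.
Proof.
move=> rM; have /rowV0Pn[x /sub_kermxP xM nx] : kermx M != 0; last by exists x.
by rewrite -mxrank_eq0 mxrank_ker subn_eq0 -ltnNge.
Qed.

Lemma kernel_cols3 c1 c2 c3 :
  exists2 x : 'rV_4, x != 0 & [/\ ev x c1 = 0, ev x c2 = 0 & ev x c3 = 0].
Proof.
have [|x nx /mul_cols3 h] := @kernel_vector _ (cols3 c1 c2 c3); last by exists x.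
exact: leq_ltn_trans (rank_leq_col _) _.
Qed.

(** The kernel has dimension at least 2, so it meets the hyperplane where coordinate [k] vanishes:
    adjoining that coordinate form as one more column keeps the rank below 4. *)
Lemma kernel_coord (M : 'M[F]_(4, 1 + (1 + 1))) (k : 'I_4) : (\rank M < 3)%N ->
  exists2 x : 'rV_4, x != 0 & x *m M = 0 /\ x 0 k = 0.
Proof.
move=> rM; pose v : 'cV[F]_4 := delta_mx k 0.
have [|x nx] := @kernel_vector _ (row_mx M v).
  rewrite -mxrank_tr tr_row_mx -addsmxE; apply: leq_ltn_trans (mxrank_adds_leqif _ _) _.
  rewrite mxrank_tr -addnS -[4%N]/(2 + 2)%N; apply: leq_add => //.
  by rewrite ltnS rank_leq_row.
rewrite mul_mx_row => /eqP; rewrite row_mx_eq0 => /andP[/eqP xM /eqP xv].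
exists x => //; split => //.
by have := congr1 (fun A : 'M_1 => A 0 0) xv; rewrite -colE !mxE.
Qed.

Lemma kernel_unique (M : 'M[F]_(4, 1 + (1 + 1))) (x x' : 'rV_4) : \rank M = 3%N ->
  x *m M = 0 -> x' *m M = 0 -> x != 0 -> exists t, x' = t *: x.
Proof.
move=> rM /sub_kermxP xM /sub_kermxP xM' nx.
have e : (x :=: kermx M)%MS.
  apply/eqmxP; rewrite -(geq_leqif (mxrank_leqif_eq xM)) mxrank_ker rM.
  by rewrite lt0n mxrank_eq0.
by move: xM'; rewrite -e => /sub_rVP.
Qed.

Lemma cols3_free c1 c2 c3 (p q r : F) : \rank (cols3 c1 c2 c3) = 3%N ->
  (forall x, p * ev x c1 + q * ev x c2 + r * ev x c3 = 0) ->
  [/\ p = 0, q = 0 & r = 0].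
Proof.
move=> rM h.
pose w : 'cV[F]_(1 + (1 + 1)) := col_mx p%:M (col_mx q%:M r%:M).
have Mw : cols3 c1 c2 c3 *m w = 0.
  (* Row [i] of the product is the assumed relation evaluated at the [i]-th basis vector. *)
  apply/row_matrixP => i; rewrite row0 rowE mulmxA /cols3 !mul_mx_row !mul_row_col.
  apply/matrixP => a b; rewrite !ord1; rewrite !mul_mx_scalar.
  rewrite [RHS]mxE -(h (delta_mx 0 i)) -addrA [LHS]mxE [X in X + _]mxE.
  by rewrite [X in _ + X]mxE [X in _ + (X + _)]mxE [X in _ + (_ + X)]mxE.
have : w^T == 0.
  have fr : row_free (cols3 c1 c2 c3)^T by rewrite /row_free mxrank_tr rM.
  by apply/eqP/(row_free_inj fr); rewrite -trmx_mul Mw trmx0 mul0mx.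
rewrite -(inj_eq trmx_inj) trmxK trmx0 !col_mx_eq0 => /and3P[h1 h2 h3].
have sc0 (s : F) : (s%:M == 0 :> 'M_1) -> s = 0.
  by move/eqP/(congr1 (fun A : 'M_1 => A 0 0)); rewrite !mxE.
by split; apply: sc0.
Qed.

End LinearForms.

(** * The trilinear form of [U8] and a hypothetical decomposition into six products *)

Section SixTerms.
Variable F : fieldType.

Local Notation "x `@ k" := (x 0 (inord k)) (at level 3, k at level 0, format "x `@ k").

(** The form T: [y], [z], [x] contract systems A, B, C, and coordinate k goes with the matrix unit
    of index k. For fixed [x] the form splits into two blocks, pairing [y] coordinates 0, 2 with [z]
    coordinates 0, 1, and [y] coordinates 1, 3 with [z] coordinates 2, 3. For fixed [z] the blocks
    pair [y] coordinates 0, 1 with [x] coordinates 0, 2, and [y] coordinates 2, 3 with [x]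
    coordinates 1, 3. *)
Definition form8 (y z x : 'rV[F]_4) : F :=
  x`@0 * (y`@0 * z`@0 + y`@1 * z`@3) + x`@1 * (y`@2 * z`@0 + y`@3 * z`@2)
  + x`@2 * (y`@0 * z`@1 + y`@1 * z`@2) + x`@3 * (y`@2 * z`@1 + y`@3 * z`@3).

Lemma row4E (p q r s : F) :
  (row4 p q r s 0 (inord 0) = p) * (row4 p q r s 0 (inord 1) = q) *
  (row4 p q r s 0 (inord 2) = r) * (row4 p q r s 0 (inord 3) = s).
Proof. by do !split; rewrite mxE inordK. Qed.

Lemma row4_eta (x : 'rV[F]_4) :
  x = row4 (x 0 (inord 0)) (x 0 (inord 1)) (x 0 (inord 2)) (x 0 (inord 3)).
Proof.
apply/rowP => k; rewrite -[k in LHS]inord_val mxE.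
by case: k => [[|[|[|[|]]]]].
Qed.

Lemma row4_eq0 (p q r s : F) :
  (row4 p q r s == 0) = [&& p == 0, q == 0, r == 0 & s == 0].
Proof.
apply/eqP/and4P => [h|[/eqP-> /eqP-> /eqP-> /eqP->]].
  by rewrite -(row4E p q r s).1.1.1 -{2}(row4E p q r s).1.1.2
     -{3}(row4E p q r s).1.2 -{4}(row4E p q r s).2 h !mxE eqxx.
by apply/rowP => -[[|[|[|[|]]]]] //= i; rewrite !mxE.
Qed.

Lemma mem_uniq6 (i j k l m n h : 'I_6) : uniq [:: i; j; k; l; m; n] ->
  h \in [:: i; j; k; l; m; n].
Proof.
move=> u; have /eqP/setP/(_ h) : [set:: [:: i; j; k; l; m; n]] == [set: 'I_6].
  by rewrite eqEcard subsetT cardsT card_ord cardsE (card_uniqP u).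
by rewrite !inE.
Qed.

Lemma uniq6_complete (i j k : 'I_6) : uniq [:: i; j; k] ->
  exists l m n, uniq [:: l; m; n; i; j; k].
Proof.
move=> u; have := cardC [in [:: i; j; k]]; rewrite (card_uniqP u) card_ord cardE.
have := enum_uniq [predC [in [:: i; j; k]]].
have : ~~ has [in [:: i; j; k]] (enum [predC [in [:: i; j; k]]]).
  by apply/hasPn => h; rewrite mem_enum.
case: (enum _) => [|l [|m [|n []]]] // dis ue _; exists l, m, n.
by rewrite (cat_uniq [:: l; m; n] [:: i; j; k]) ue u has_sym dis.
Qed.

Lemma sum_uniq6 (f : 'I_6 -> F) i j k l m n : uniq [:: i; j; k; l; m; n] ->
  \sum_h f h = f i + f j + f k + f l + f m + f n.
Proof.
move=> u; rewrite (perm_big [:: i; j; k; l; m; n]) /=; last first.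
  apply: uniq_perm => //; first exact: index_enum_uniq.
  by move=> h; rewrite mem_index_enum mem_uniq6.
by rewrite !big_cons big_nil addr0 !addrA.
Qed.

(* [edge f i j]: the four forms other than [f i] and [f j] are dependent. *)
Definition edge (f : 'I_6 -> 'cV[F]_4) : rel 'I_6 := fun i j =>
  `[< i != j /\ exists2 x, x != 0 & forall k, k != i -> k != j -> ev x (f k) = 0 >].

(** If [i] were joined to both [j] and [k], the two witnesses would lie in the common kernel of the
    other three forms, which is a line. Being proportional, each would be killed by every form
    except [f i], hence be zero. *)
Lemma edge_matching (f : 'I_6 -> 'cV[F]_4) :
  (forall i j k l m n, uniq [:: i; j; k; l; m; n] ->
     \rank (cols3 (f i) (f j) (f k)) = 3%N) ->
  (forall i x, (forall k, k != i -> ev x (f k) = 0) -> x = 0) ->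
  matching (edge f).
Proof.
move=> rk one; split=> [i j|i j k].
  by apply/asboolP/asboolP => -[ij [x nx h]]; split; rewrite 1?eq_sym //;
    exists x => // k ? ?; apply: h.
move=> /asboolP[ij [x nx hx]] /asboolP[ik [x' nx' hx']]; apply/eqP/negPn/negP => jk.
have [|l [m [n u]]] := @uniq6_complete i j k.
  by rewrite /= !inE negb_or ij ik jk.
have kill v p : (forall h, h != i -> h != p -> ev v (f h) = 0) -> p \in [:: j; k] ->
    v *m cols3 (f l) (f m) (f n) = 0.
  move=> hv pjk; apply/mul_cols3; move: u; rewrite /= !inE !negb_or.
  move=> /and5P[/and5P[_ _ li lj lk] /and4P[_ mi mj mk] /and3P[ni nj nk] _ _].
  by move: pjk; rewrite !inE => /orP[] /eqP e; subst p; split; apply: hv.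
have [||t x'E] := kernel_unique (rk _ _ _ _ _ _ u) (kill _ _ hx _) (kill _ _ hx' _) nx.
- by rewrite !inE eqxx.
- by rewrite !inE eqxx orbT.
have nt : t != 0 by apply: contraNneq nx' => t0; rewrite x'E t0 scale0r.
have xj : ev x (f j) = 0.
  have := hx' j; rewrite eq_sym => /(_ ij jk).
  by rewrite x'E /ev -scalemxAl mxE => /eqP; rewrite mulf_eq0 (negbTE nt) => /eqP.
case/eqP: nx; apply: (one i) => h hi.
by have [->|hj] := eqVneq h j; [|apply: hx].
Qed.

Variables a b c : 'I_6 -> 'cV[F]_4.
Hypothesis abcE : forall y z x,
  \sum_j ev y (a j) * ev z (b j) * ev x (c j) = form8 y z x.

Lemma form8_split i j k l m n y z x : uniq [:: i; j; k; l; m; n] ->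
  form8 y z x =
    ev y (a i) * ev z (b i) * ev x (c i) + ev y (a j) * ev z (b j) * ev x (c j) +
    ev y (a k) * ev z (b k) * ev x (c k) + ev y (a l) * ev z (b l) * ev x (c l) +
    ev y (a m) * ev z (b m) * ev x (c m) + ev y (a n) * ev z (b n) * ev x (c n).
Proof. by move=> u; rewrite -abcE; exact: sum_uniq6 u. Qed.


(** * Independence of any three forms of one system *)

Lemma row_neq0 (x : 'rV[F]_4) : x != 0 ->
  [|| x`@0 != 0, x`@1 != 0, x`@2 != 0 | x`@3 != 0].
Proof. by rewrite {1}[x]row4_eta row4_eq0 !negb_and. Qed.

(* [L] behaves like a plane: it meets every coordinate hyperplane. *)
Lemma plane_block_vector (L : 'rV[F]_4 -> Prop) (s t : F) (i j : 'I_4) :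
  (forall h, exists2 y, y != 0 & L y /\ y 0 h = 0) ->
  (s != 0) || (t != 0) -> (forall y, L y -> s * y 0 i + t * y 0 j = 0) ->
  exists2 y, y != 0 & [/\ L y, y 0 i = 0 & y 0 j = 0].
Proof.
move=> K + E => /orP[|] nz.
  have [y ny [Ly yj]] := K j; exists y => //; split=> //; apply/eqP.
  by move/eqP: (E _ Ly); rewrite yj mulr0 addr0 mulf_eq0 (negbTE nz).
have [y ny [Ly yi]] := K i; exists y => //; split=> //; apply/eqP.
by move/eqP: (E _ Ly); rewrite yi mulr0 add0r mulf_eq0 (negbTE nz).
Qed.

Lemma mulf0_pair (p q r s : F) : (p != 0) || (q != 0) ->
  p * r = 0 -> q * r = 0 -> p * s = 0 -> q * s = 0 -> r = 0 /\ s = 0.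
Proof.
move=> /orP[|] /negbTE nz /eqP + /eqP + /eqP + /eqP;
by rewrite !mulf_eq0 nz /= => h1 h2 h3 h4; split; apply/eqP.
Qed.

Ltac form8_ring e := rewrite -[RHS]e /form8 !row4E; ring.

(** If the three forms were dependent, their kernel [L] would contain a plane. Choosing [x] and [z]
    to kill the other three terms makes T vanish on [L] with either one. The equations from [x] give
    vectors of [L] supported on coordinates 1, 3 and on coordinates 0, 2; these two vectors then
    force [z] to be zero. *)
Lemma rank_a i j k l m n : uniq [:: i; j; k; l; m; n] ->
  \rank (cols3 (a i) (a j) (a k)) = 3%N.
Proof.
move=> u; apply/eqP; rewrite eqn_leq rank_leq_col leqNgt; apply/negP => rk.
have [x nx [xl xm xn]] := kernel_cols3 (c l) (c m) (c n).
have [z nz [zl zm zn]] := kernel_cols3 (b l) (b m) (b n).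
pose L (v : 'rV[F]_4) := v *m cols3 (a i) (a j) (a k) = 0.
have K h : exists2 v, v != 0 & L v /\ v 0 h = 0 by exact: kernel_coord.
have Lx v w : L v -> form8 v w x = 0.
  case/mul_cols3=> vi vj vk; rewrite (form8_split _ _ _ u).
  by rewrite vi vj vk xl xm xn !(mul0r, mulr0, addr0).
have Lz v w : L v -> form8 v z w = 0.
  case/mul_cols3=> vi vj vk; rewrite (form8_split _ _ _ u).
  by rewrite vi vj vk zl zm zn !(mul0r, mulr0, addr0).
have [v nv [Lv v0 v2]] : exists2 v, v != 0 & [/\ L v, v`@0 = 0 & v`@2 = 0].
  (* Coordinates 0 and 1 of the free argument yield two linear relations between coordinates 0 and 2
     of a vector of [L]; since [x] is nonzero, one of them is nontrivial. *)
  have [h|h] := boolP ((x`@0 != 0) || (x`@1 != 0)).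
    by apply: (plane_block_vector K h) => t /(Lx _ (row4 1 0 0 0)) e; form8_ring e.
  have {}h : (x`@2 != 0) || (x`@3 != 0) by move: (row_neq0 nx) h; do 4 case: (_ == 0).
  by apply: (plane_block_vector K h) => t /(Lx _ (row4 0 1 0 0)) e; form8_ring e.
have [w nw [Lw w1 w3]] : exists2 v, v != 0 & [/\ L v, v`@1 = 0 & v`@3 = 0].
  have [h|h] := boolP ((x`@2 != 0) || (x`@1 != 0)).
    by apply: (plane_block_vector K h) => t /(Lx _ (row4 0 0 1 0)) e; form8_ring e.
  have {}h : (x`@0 != 0) || (x`@3 != 0) by move: (row_neq0 nx) h; do 4 case: (_ == 0).
  by apply: (plane_block_vector K h) => t /(Lx _ (row4 0 0 0 1)) e; form8_ring e.
have [z2 z3] : z`@2 = 0 /\ z`@3 = 0.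
  apply: (@mulf0_pair v`@1 v`@3).
  - by move: (row_neq0 nv); rewrite v0 v2 eqxx ?orbF.
  - by have := Lz _ (row4 0 0 1 0) Lv; rewrite /form8 !row4E v0 v2 => e; rewrite -[RHS]e; ring.
  - by have := Lz _ (row4 0 1 0 0) Lv; rewrite /form8 !row4E v0 v2 => e; rewrite -[RHS]e; ring.
  - by have := Lz _ (row4 1 0 0 0) Lv; rewrite /form8 !row4E v0 v2 => e; rewrite -[RHS]e; ring.
  - by have := Lz _ (row4 0 0 0 1) Lv; rewrite /form8 !row4E v0 v2 => e; rewrite -[RHS]e; ring.
have [z0 z1] : z`@0 = 0 /\ z`@1 = 0.
  apply: (@mulf0_pair w`@0 w`@2).
  - by move: (row_neq0 nw); rewrite w1 w3 eqxx ?orbF.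
  - by have := Lz _ (row4 1 0 0 0) Lw; rewrite /form8 !row4E w1 w3 => e; rewrite -[RHS]e; ring.
  - by have := Lz _ (row4 0 1 0 0) Lw; rewrite /form8 !row4E w1 w3 => e; rewrite -[RHS]e; ring.
  - by have := Lz _ (row4 0 0 1 0) Lw; rewrite /form8 !row4E w1 w3 => e; rewrite -[RHS]e; ring.
  - by have := Lz _ (row4 0 0 0 1) Lw; rewrite /form8 !row4E w1 w3 => e; rewrite -[RHS]e; ring.
by move: (row_neq0 nz); rewrite z0 z1 z2 z3 eqxx.
Qed.

(** Same argument as for [rank_a]: here [z] supplies the relations, the coordinates pair up as 0, 2
    and 1, 3, and [y] is forced to vanish. *)
Lemma rank_c i j k l m n : uniq [:: i; j; k; l; m; n] ->
  \rank (cols3 (c i) (c j) (c k)) = 3%N.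
Proof.
move=> u; apply/eqP; rewrite eqn_leq rank_leq_col leqNgt; apply/negP => rk.
have [z nz [zl zm zn]] := kernel_cols3 (b l) (b m) (b n).
have [y ny [yl ym yn]] := kernel_cols3 (a l) (a m) (a n).
pose L (v : 'rV[F]_4) := v *m cols3 (c i) (c j) (c k) = 0.
have K h : exists2 v, v != 0 & L v /\ v 0 h = 0 by exact: kernel_coord.
have Lz v w : L v -> form8 w z v = 0.
  case/mul_cols3=> vi vj vk; rewrite (form8_split _ _ _ u).
  by rewrite vi vj vk zl zm zn !(mul0r, mulr0, addr0).
have Ly v w : L v -> form8 y w v = 0.
  case/mul_cols3=> vi vj vk; rewrite (form8_split _ _ _ u).
  by rewrite vi vj vk yl ym yn !(mul0r, mulr0, addr0).
have [v nv [Lv v0 v2]] : exists2 v, v != 0 & [/\ L v, v`@0 = 0 & v`@2 = 0].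
  have [h|h] := boolP ((z`@0 != 0) || (z`@1 != 0)).
    by apply: (plane_block_vector K h) => t /(Lz _ (row4 1 0 0 0)) e; form8_ring e.
  have {}h : (z`@3 != 0) || (z`@2 != 0) by move: (row_neq0 nz) h; do 4 case: (_ == 0).
  by apply: (plane_block_vector K h) => t /(Lz _ (row4 0 1 0 0)) e; form8_ring e.
have [w nw [Lw w1 w3]] : exists2 v, v != 0 & [/\ L v, v`@1 = 0 & v`@3 = 0].
  have [h|h] := boolP ((z`@0 != 0) || (z`@1 != 0)).
    by apply: (plane_block_vector K h) => t /(Lz _ (row4 0 0 1 0)) e; form8_ring e.
  have {}h : (z`@2 != 0) || (z`@3 != 0) by move: (row_neq0 nz) h; do 4 case: (_ == 0).
  by apply: (plane_block_vector K h) => t /(Lz _ (row4 0 0 0 1)) e; form8_ring e.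
have [y2 y3] : y`@2 = 0 /\ y`@3 = 0.
  apply: (@mulf0_pair v`@1 v`@3).
  - by move: (row_neq0 nv); rewrite v0 v2 eqxx ?orbF.
  - by have := Ly _ (row4 1 0 0 0) Lv; rewrite /form8 !row4E v0 v2 => e; rewrite -[RHS]e; ring.
  - by have := Ly _ (row4 0 1 0 0) Lv; rewrite /form8 !row4E v0 v2 => e; rewrite -[RHS]e; ring.
  - by have := Ly _ (row4 0 0 1 0) Lv; rewrite /form8 !row4E v0 v2 => e; rewrite -[RHS]e; ring.
  - by have := Ly _ (row4 0 0 0 1) Lv; rewrite /form8 !row4E v0 v2 => e; rewrite -[RHS]e; ring.
have [y0 y1] : y`@0 = 0 /\ y`@1 = 0.
  apply: (@mulf0_pair w`@0 w`@2).
  - by move: (row_neq0 nw); rewrite w1 w3 eqxx ?orbF.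
  - by have := Ly _ (row4 1 0 0 0) Lw; rewrite /form8 !row4E w1 w3 => e; rewrite -[RHS]e; ring.
  - by have := Ly _ (row4 0 1 0 0) Lw; rewrite /form8 !row4E w1 w3 => e; rewrite -[RHS]e; ring.
  - by have := Ly _ (row4 0 0 0 1) Lw; rewrite /form8 !row4E w1 w3 => e; rewrite -[RHS]e; ring.
  - by have := Ly _ (row4 0 0 1 0) Lw; rewrite /form8 !row4E w1 w3 => e; rewrite -[RHS]e; ring.
by move: (row_neq0 ny); rewrite y0 y1 y2 y3 eqxx.
Qed.

(** Here [x] supplies the relations, the coordinates pair up as 0, 1 and 2, 3, and [y] is forced to
    vanish. *)
Lemma rank_b i j k l m n : uniq [:: i; j; k; l; m; n] ->
  \rank (cols3 (b i) (b j) (b k)) = 3%N.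
Proof.
move=> u; apply/eqP; rewrite eqn_leq rank_leq_col leqNgt; apply/negP => rk.
have [x nx [xl xm xn]] := kernel_cols3 (c l) (c m) (c n).
have [y ny [yl ym yn]] := kernel_cols3 (a l) (a m) (a n).
pose L (v : 'rV[F]_4) := v *m cols3 (b i) (b j) (b k) = 0.
have K h : exists2 v, v != 0 & L v /\ v 0 h = 0 by exact: kernel_coord.
have Lx v w : L v -> form8 w v x = 0.
  case/mul_cols3=> vi vj vk; rewrite (form8_split _ _ _ u).
  by rewrite vi vj vk xl xm xn !(mul0r, mulr0, addr0).
have Ly v w : L v -> form8 y v w = 0.
  case/mul_cols3=> vi vj vk; rewrite (form8_split _ _ _ u).
  by rewrite vi vj vk yl ym yn !(mul0r, mulr0, addr0).
have [v nv [Lv v0 v1]] : exists2 v, v != 0 & [/\ L v, v`@0 = 0 & v`@1 = 0].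
  have [h|h] := boolP ((x`@0 != 0) || (x`@2 != 0)).
    by apply: (plane_block_vector K h) => t /(Lx _ (row4 1 0 0 0)) e; form8_ring e.
  have {}h : (x`@1 != 0) || (x`@3 != 0) by move: (row_neq0 nx) h; do 4 case: (_ == 0).
  by apply: (plane_block_vector K h) => t /(Lx _ (row4 0 0 1 0)) e; form8_ring e.
have [w nw [Lw w2 w3]] : exists2 v, v != 0 & [/\ L v, v`@2 = 0 & v`@3 = 0].
  have [h|h] := boolP ((x`@2 != 0) || (x`@0 != 0)).
    by apply: (plane_block_vector K h) => t /(Lx _ (row4 0 1 0 0)) e; form8_ring e.
  have {}h : (x`@1 != 0) || (x`@3 != 0) by move: (row_neq0 nx) h; do 4 case: (_ == 0).
  by apply: (plane_block_vector K h) => t /(Lx _ (row4 0 0 0 1)) e; form8_ring e.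
have [y1 y3] : y`@1 = 0 /\ y`@3 = 0.
  apply: (@mulf0_pair v`@2 v`@3).
  - by move: (row_neq0 nv); rewrite v0 v1 eqxx ?orbF.
  - by have := Ly _ (row4 0 0 1 0) Lv; rewrite /form8 !row4E v0 v1 => e; rewrite -[RHS]e; ring.
  - by have := Ly _ (row4 1 0 0 0) Lv; rewrite /form8 !row4E v0 v1 => e; rewrite -[RHS]e; ring.
  - by have := Ly _ (row4 0 1 0 0) Lv; rewrite /form8 !row4E v0 v1 => e; rewrite -[RHS]e; ring.
  - by have := Ly _ (row4 0 0 0 1) Lv; rewrite /form8 !row4E v0 v1 => e; rewrite -[RHS]e; ring.
have [y0 y2] : y`@0 = 0 /\ y`@2 = 0.
  apply: (@mulf0_pair w`@0 w`@1).
  - by move: (row_neq0 nw); rewrite w2 w3 eqxx ?orbF.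
  - by have := Ly _ (row4 1 0 0 0) Lw; rewrite /form8 !row4E w2 w3 => e; rewrite -[RHS]e; ring.
  - by have := Ly _ (row4 0 0 1 0) Lw; rewrite /form8 !row4E w2 w3 => e; rewrite -[RHS]e; ring.
  - by have := Ly _ (row4 0 1 0 0) Lw; rewrite /form8 !row4E w2 w3 => e; rewrite -[RHS]e; ring.
  - by have := Ly _ (row4 0 0 0 1) Lw; rewrite /form8 !row4E w2 w3 => e; rewrite -[RHS]e; ring.
by move: (row_neq0 ny); rewrite y0 y1 y2 y3 eqxx.
Qed.


(** A contraction with a single surviving term has rank at most 1, so its 2 by 2 minors vanish. Each
    coordinate of [v] appears once in each of the two diagonal blocks, and the minor on these two
    entries, with a zero off the diagonal, says that its square is zero. *)
Lemma one_term i : (forall x, (forall k, k != i -> ev x (c k) = 0) -> x = 0) /\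
  (forall z, (forall k, k != i -> ev z (b k) = 0) -> z = 0).
Proof.
have sq0 (p r s : F) : p = r -> p = s -> r * s = 0 -> p = 0.
  by move=> <- <- /eqP; rewrite mulf_eq0 orbb => /eqP.
split=> v hv.
  have E y z : form8 y z v = ev y (a i) * ev z (b i) * ev v (c i).
    rewrite -abcE (bigD1 i) //= big1 ?addr0 // => k ki.
    by rewrite hv ?mulr0.
  have X y z y' z' : form8 y z' v = 0 -> form8 y z v * form8 y' z' v = 0.
    move=> h; transitivity (form8 y z' v * form8 y' z v); last by rewrite h mul0r.
    by rewrite !E; ring.
  rewrite [v]row4_eta; apply/eqP; rewrite row4_eq0; apply/and4P; split; apply/eqP.
  - by apply: sq0 (X (row4 1 0 0 0) (row4 1 0 0 0) (row4 0 1 0 0) (row4 0 0 0 1) _);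
      rewrite /form8 !row4E; ring.
  - by apply: sq0 (X (row4 0 0 1 0) (row4 1 0 0 0) (row4 0 0 0 1) (row4 0 0 1 0) _);
      rewrite /form8 !row4E; ring.
  - by apply: sq0 (X (row4 1 0 0 0) (row4 0 1 0 0) (row4 0 1 0 0) (row4 0 0 1 0) _);
      rewrite /form8 !row4E; ring.
  - by apply: sq0 (X (row4 0 0 1 0) (row4 0 1 0 0) (row4 0 0 0 1) (row4 0 0 0 1) _);
      rewrite /form8 !row4E; ring.
have E y x : form8 y v x = ev y (a i) * ev v (b i) * ev x (c i).
  rewrite -abcE (bigD1 i) //= big1 ?addr0 // => k ki.
  by rewrite hv ?mulr0 ?mul0r.
have X y x y' x' : form8 y v x' = 0 -> form8 y v x * form8 y' v x' = 0.
  move=> h; transitivity (form8 y v x' * form8 y' v x); last by rewrite h mul0r.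
  by rewrite !E; ring.
rewrite [v]row4_eta; apply/eqP; rewrite row4_eq0; apply/and4P; split; apply/eqP.
- by apply: sq0 (X (row4 1 0 0 0) (row4 1 0 0 0) (row4 0 0 1 0) (row4 0 1 0 0) _);
    rewrite /form8 !row4E; ring.
- by apply: sq0 (X (row4 1 0 0 0) (row4 0 0 1 0) (row4 0 0 1 0) (row4 0 0 0 1) _);
    rewrite /form8 !row4E; ring.
- by apply: sq0 (X (row4 0 1 0 0) (row4 0 0 1 0) (row4 0 0 0 1) (row4 0 1 0 0) _);
    rewrite /form8 !row4E; ring.
- by apply: sq0 (X (row4 0 1 0 0) (row4 1 0 0 0) (row4 0 0 0 1) (row4 0 0 0 1) _);
    rewrite /form8 !row4E; ring.
Qed.

(* Contracting [form8] with [x] gives a block-diagonal bilinear form, and each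
   block component of [z] contracts it to a matrix of rank 2. *)
Lemma block_vector z x : z != 0 -> (forall y, form8 y z x = 0) ->
  exists2 w, w != 0 & (forall y, form8 y w x = 0) /\
    exists e e', [/\ e != 0, forall t, e' <> t *: e,
      forall x', form8 e w x' = 0 & forall x', form8 e' w x' = 0].
Proof.
move=> nz hz.
have [h|h] := boolP ((z`@0 != 0) || (z`@1 != 0)).
  exists (row4 z`@0 z`@1 0 0); first by rewrite row4_eq0 !negb_and orbA h.
  split=> [y|].
    (* Keeping only coordinates 0 and 2 of [y] isolates the block that sees coordinates 0 and 1 of
       [z]. *)
    by rewrite -[RHS](hz (row4 y`@0 0 y`@2 0)) /form8 !row4E; ring.
  exists (row4 0 1 0 0), (row4 0 0 0 1); split=> [|t /rowP/(_ (inord 3))|x'|x'].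
  - by rewrite row4_eq0 !negb_and oner_eq0 orbT.
  - by rewrite [RHS]mxE !row4E mulr0 => /eqP; rewrite oner_eq0.
  - by rewrite /form8 !row4E; ring.
  - by rewrite /form8 !row4E; ring.
have {}h : (z`@2 != 0) || (z`@3 != 0) by move: (row_neq0 nz) h; do 4 case: (_ == 0).
exists (row4 0 0 z`@2 z`@3); first by rewrite row4_eq0 !negb_and h !orbT.
split=> [y|].
  by rewrite -[RHS](hz (row4 0 y`@1 0 y`@3)) /form8 !row4E; ring.
exists (row4 1 0 0 0), (row4 0 0 1 0); split=> [|t /rowP/(_ (inord 2))|x'|x'].
- by rewrite row4_eq0 !negb_and oner_eq0.
- by rewrite [RHS]mxE !row4E mulr0 => /eqP; rewrite oner_eq0.
- by rewrite /form8 !row4E; ring.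
- by rewrite /form8 !row4E; ring.
Qed.

(** * Edges forced by a split into triples, and the contradiction *)

Lemma edge4 (f : 'I_6 -> 'cV[F]_4) v i j k l m n : uniq [:: i; j; k; l; m; n] -> v != 0 ->
  ev v (f i) = 0 -> ev v (f j) = 0 -> ev v (f k) = 0 ->
  [/\ ev v (f l) = 0 -> edge f m n, ev v (f m) = 0 -> edge f l n
    & ev v (f n) = 0 -> edge f l m].
Proof.
move=> u nv vi vj vk.
have [lm ln mn] : [/\ l != m, l != n & m != n].
  by move: u; rewrite /= !inE !negb_or => /and5P[_ _ _ /andP[-> ->] /andP[-> _]].
by split=> h; apply/asboolP; split=> //; exists v => // p p1 p2;
  move: (mem_uniq6 p u); rewrite !inE => /or4P[/eqP-> //|/eqP-> //|/eqP-> //|/or3P[]/eqP pE];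
  move: p1 p2; rewrite pE ?eqxx.
Qed.

Lemma split_edge i j k l m n : uniq [:: i; j; k; l; m; n] ->
  [|| edge b i j, edge b i k | edge b j k] || [|| edge c l m, edge c l n | edge c m n].
Proof.
move=> u; have u' : uniq [:: l; m; n; i; j; k] by rewrite (uniq_catC [:: l; m; n] [:: i; j; k]).
have [x nx [xi xj xk]] := kernel_cols3 (c i) (c j) (c k).
have [z nz [zl zm zn]] := kernel_cols3 (b l) (b m) (b n).
have [|w nw [hw [e [e' [ne e'e he he']]]]] := @block_vector z x nz.
  move=> y; rewrite (form8_split _ _ _ u).
  by rewrite xi xj xk zl zm zn !(mul0r, mulr0, addr0).
have [cl cm cn] := edge4 u nx xi xj xk.
(* Only terms [l], [m], [n] survive at [x], and their [a] forms are independent. So either [x] kills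
   a fourth [c], giving an edge inside the second triple, or [w] kills [b l], [b m] and [b n]. *)
have [l0 m0 n0] : [/\ ev w (b l) * ev x (c l) = 0, ev w (b m) * ev x (c m) = 0
    & ev w (b n) * ev x (c n) = 0].
  apply: (cols3_free (rank_a u')) => y.
  by rewrite -[RHS](hw y) (form8_split _ _ _ u) xi xj xk; ring.
have or0 (p q : F) : p * q = 0 -> p = 0 \/ q = 0.
  by move/eqP; rewrite mulf_eq0 => /orP[]/eqP; [left | right].
have [wl|/cl->] := or0 _ _ l0; last by rewrite !orbT.
have [wm|/cm->] := or0 _ _ m0; last by rewrite !orbT.
have [wn|/cn->] := or0 _ _ n0; last by rewrite !orbT.
have [bi bj bk] := edge4 u' nw wl wm wn.
(* Now only terms [i], [j], [k] survive at [w], and their [c] forms are independent. *)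
have K v : (forall x', form8 v w x' = 0) -> [/\ ev w (b i) * ev v (a i) = 0,
    ev w (b j) * ev v (a j) = 0 & ev w (b k) * ev v (a k) = 0].
  move=> hv; apply: (cols3_free (rank_c u)) => x'.
  by rewrite -[RHS](hv x') (form8_split _ _ _ u) wl wm wn; ring.
have [ei ej ek] := K _ he; have [e'i e'j e'k] := K _ he'.
have [wi|wi] := eqVneq (ev w (b i)) 0; first by rewrite (bi wi) !orbT.
have [wj|wj] := eqVneq (ev w (b j)) 0; first by rewrite (bj wj) !orbT.
have [wk|wk] := eqVneq (ev w (b k)) 0; first by rewrite (bk wk).
have cancel0 (p q : F) : p != 0 -> p * q = 0 -> q = 0.
  by move=> np /or0[p0|//]; rewrite p0 eqxx in np.
(* If [w] kills no fourth [b], then [e] and [e'] both lie in the kernel of [a i], [a j], [a k],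
   which is a line, against their independence. *)
have [] := @kernel_unique F (cols3 (a i) (a j) (a k)) e e' (rank_a u) _ _ ne.
- by apply/mul_cols3; split; [exact: cancel0 ei|exact: cancel0 ej|exact: cancel0 ek].
- by apply/mul_cols3; split; [exact: cancel0 e'i|exact: cancel0 e'j|exact: cancel0 e'k].
by move=> t /e'e.
Qed.

Lemma not_six_terms : False.
Proof.
have mb : matching (edge b) by apply: edge_matching rank_b _ => i; exact: (one_term i).2.
have mc : matching (edge c) by apply: edge_matching rank_c _ => i; exact: (one_term i).1.
have [i [j [k [l [m [n [u h]]]]]]] := matchings_split mb mc.
by have := split_edge u; rewrite h.
Qed.

End SixTerms.

(** * From tensor decompositions to trilinear forms, and the two rank bounds *)

Section SchmidtRank.
Variable F : fieldType.

(** The matrix unit of index [s] has its 1 in row [s %/ 2] and column [s %% 2]. *)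
Definition row_idx (s : 'I_4) : 'I_2 := inord (s %/ 2).
Definition col_idx (s : 'I_4) : 'I_2 := inord (s %% 2).

(** The coefficient of [U] on the tensor product of the matrix units of indices [s], [t], [u]. *)
Definition coef3 (U : 'M[F]_(2 * 2 * 2)) (s t u : 'I_4) : F :=
  U (mxtens_index (mxtens_index (row_idx s, row_idx t), row_idx u))
    (mxtens_index (mxtens_index (col_idx s, col_idx t), col_idx u)).

Definition form_of_mx (A : 'M[F]_2) : 'cV[F]_4 := \col_s A (row_idx s) (col_idx s).

Definition contract (y z x : 'rV[F]_4) (U : 'M[F]_(2 * 2 * 2)) : F :=
  \sum_s \sum_t \sum_u y 0 s * z 0 t * x 0 u * coef3 U s t u.

Lemma contract_tens3 y z x A B C : contract y z x (tens3 A B C) =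
  ev y (form_of_mx A) * ev z (form_of_mx B) * ev x (form_of_mx C).
Proof.
have evE v (D : 'cV[F]_4) : ev v D = \sum_k v 0 k * D k 0 by rewrite /ev mxE.
rewrite !evE !mulr_suml; apply: eq_bigr => s _.
rewrite [X in _ = X * _]mulr_sumr mulr_suml; apply: eq_bigr => t _.
rewrite mulr_sumr; apply: eq_bigr => u _.
by rewrite /coef3 /tens3 !tensmxE !mxE; ring.
Qed.

Lemma contractD y z x U V : contract y z x (U + V) = contract y z x U + contract y z x V.
Proof.
rewrite /contract -big_split; apply: eq_bigr => s _ /=.
rewrite -big_split; apply: eq_bigr => t _ /=.
rewrite -big_split; apply: eq_bigr => u _ /=.
by rewrite /coef3 mxE mulrDr.
Qed.

Lemma contract0 y z x : contract y z x 0 = 0.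
Proof.
by rewrite /contract big1 // => s _; rewrite big1 // => t _; rewrite big1 // => u _;
  rewrite /coef3 mxE mulr0.
Qed.

Lemma ev_delta (y : 'rV[F]_4) (i j : 'I_2) :
  ev y (form_of_mx (delta_mx i j)) = y 0 (inord (i * 2 + j)).
Proof.
rewrite /ev mxE (bigD1 (inord (i * 2 + j))) //= big1 ?addr0.
  rewrite !mxE /row_idx /col_idx inordK; last exact: (@mxtens_index_proof 2 2 (i, j)).
  rewrite divnMDl // divn_small // addn0 modnMDl modn_small // !inord_val !eqxx.
  by rewrite mulr1.
move=> s ns; rewrite !mxE; case: eqVneq => [ri|]; rewrite ?mulr0 //=.
case: eqVneq => [cj|]; rewrite ?mulr0 //.
case/eqP: ns; apply: val_inj; rewrite -ri -cj /row_idx /col_idx /=.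
by case: s {ri cj} => [[|[|[|[|]]]]] //= ?; rewrite !inordK.
Qed.

Lemma contract_U8 y z x : contract y z x U8 = form8 y z x.
Proof.
rewrite /U8 !contractD !contract_tens3 !ev_delta /form8 /=.
by ring.
Qed.

(** Padding with [d] zero terms; this reduces every length up to 6 to exactly 6. *)
Lemma sr_le_widen (U : 'M[F]_(2 * 2 * 2)) r d : sr_le U r -> sr_le U (d + r).
Proof.
case=> A [B [C UE]].
pose ext (f : 'I_r -> 'M[F]_2) (j : 'I_(d + r)) := if split j is inr k then f k else 0.
exists (ext A), (ext B), (ext C); rewrite big_split_ord /= big1 ?add0r.
  rewrite UE; apply: eq_bigr => j _; rewrite /ext.
  by rewrite -[rshift d j]/(unsplit (inr j)) unsplitK.
move=> j _; rewrite /ext -[lshift r j]/(unsplit (inl j)) unsplitK.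
by rewrite /tens3 !tens0mx.
Qed.

Lemma U8_sr_gt6 r : sr_le (@U8 F) r -> (6 < r)%N.
Proof.
rewrite ltnNge => h; apply/negP => r6.
have [A [B [C UE]]] : sr_le (@U8 F) 6 by rewrite -(subnK r6); exact: sr_le_widen.
apply: (@not_six_terms F (form_of_mx \o A) (form_of_mx \o B) (form_of_mx \o C)) => y z x.
rewrite -contract_U8 UE (big_morph _ (contractD y z x) (contract0 y z x)).
by apply: eq_bigr => j _; rewrite contract_tens3.
Qed.

Lemma U8_sr_le8 : sr_le (@U8 F) 8.
Proof.
(* The three lists are the A, B and C factors of the eight defining summands, in order. *)
exists (fun j => nth 0 [:: S0; S1; S2; S3; S0; S1; S2; S3] j),
       (fun j => nth 0 [:: S0; S3; S0; S2; S1; S2; S1; S3] j),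
       (fun j => nth 0 [:: S0; S0; S1; S1; S2; S2; S3; S3] j).
by rewrite !big_ord_recr big_ord0 /= add0r.
Qed.

End SchmidtRank.

Theorem theorem5 (R : realType) :
  is_sr (@U8 R[i]) 7 \/ is_sr (@U8 R[i]) 8.
Proof.
(* A classical case split on whether seven terms suffice; the lower bound 7 settles minimality in
   the first case, and excluding 7 raises it to 8 in the second. *)
have [h7|h7] := pselect (sr_le (@U8 R[i]) 7); [left | right].
  by split=> // r; exact: U8_sr_gt6.
split=> [|r hr]; first exact: U8_sr_le8.
have := U8_sr_gt6 hr; rewrite leq_eqVlt => /orP[/eqP r7|//].
by case: h7; rewrite r7.
Qed.
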